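(* Let $n\ge1$. For each extension $\mathcal{L}$ of $\mathrm{BD}_\infty$ the following are equivalent: (i) $\mathcal{L}$ is a finitary extension of $\mathrm{BD}_n$ with the PCP; (ii) $\mathcal{L}$ is complete with respect to some set of substructures of $\boldsymbol{\mathcal{DM}}_n$; (iii) $\mathcal{L}$ is complete with respect to some finite set of finite structures $\langle\mathbf{L},F\rangle$ with $\mathbf{L}$ a De~Morgan lattice and $F$ a prime $n$-filter of $\mathbf{L}$. Moreover, for each finitely generated extension of $\mathrm{BD}_\infty$ with the PCP there is some $n$ for which these conditions hold.
   Context: Formulas are built from variables using $\wedge,\vee,\neg$. A structure is a pair $\langle\mathbf{A},F\rangle$, $F\subseteq A$; a rule $\Gamma\vdash\varphi$ is valid in it if every homomorphism $v$ from the formula algebra with $v[\Gamma]\subseteq F$ has $v(\varphi)\in F$. A logic is a substitution-invariant consequence relation; complete w.r.t. a class of structures means its valid rules are exactly those valid in all members; finitary means $\Gamma\vdash\varphi$ implies $\Gamma_0\vdash\varphi$ for some finite $\Gamma_0\subseteq\Gamma$; finitely generated means determined by a finite set of finite structures; the extension by rules is the smallest logic containing the given one and the rules. $\mathrm{BD}_\infty$ is the logic determined by all $\langle\mathbf{A},F\rangle$ with $\mathbf{A}$ a De~Morgan lattice (distributive lattice with $\neg$, $\neg\neg x=x$, De~Morgan laws) and $F$ an upset; $\mathrm{BD}_n$ is its extension by $\{\bigwedge_{j\ne i}x_j:1\le i\le n+1\}\vdash x_1\wedge\dots\wedge x_{n+1}$. $\mathcal{L}$ has the PCP if $\Gamma,\varphi_1\vdash_{\mathcal{L}}\psi$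 and $\Gamma,\varphi_2\vdash_{\mathcal{L}}\psi$ imply $\Gamma,\varphi_1\vee\varphi_2\vdash_{\mathcal{L}}\psi$. $\mathbf{DM}_1$ is the De~Morgan lattice on $\{\mathsf f,\mathsf n,\mathsf b,\mathsf t\}$, $\mathsf f<\mathsf n,\mathsf b<\mathsf t$, $\mathsf n,\mathsf b$ incomparable, $\neg\mathsf t=\mathsf f$, $\neg\mathsf n=\mathsf n$, $\neg\mathsf b=\mathsf b$; $\boldsymbol{\mathcal{DM}}_n=\langle(\mathbf{DM}_1)^n,Q_n\rangle$ where $Q_n$ is the set of tuples with some coordinate in $\{\mathsf t,\mathsf b\}$. A substructure is a subalgebra with the restricted designated set. An $n$-filter is an upset $F$ such that for every non-empty finite $Y$: if $\bigwedge X\in F$ for all non-empty $X\subseteq Y$ with $|X|\le n$, then $\bigwedge Y\in F$; it is prime if $x\vee y\in F$ implies $x\in F$ or $y\in F$. *)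

(* Defs.v *)
From mathcomp Require Import all_boot.
From mathcomp Require Import boolp classical_sets functions cardinality.

Set Implicit Arguments.
Unset Strict Implicit.
Unset Printing Implicit Defensive.

Local Open Scope classical_set_scope.

(* Algebras in the signature (/\, \/, ~); as usual, the universe is non-empty. *)
Record algebra : Type := Algebra {
  carrier :> Type;
  meet : carrier -> carrier -> carrier;
  join : carrier -> carrier -> carrier;
  neg : carrier -> carrier;
  carrier_nonempty : inhabited carrier
}.

Record structure : Type := Structure {
  str_alg :> algebra;
  designated : set str_alg
}.

Arguments designated : clear implicits.

Definition is_hom (A B : algebra) (h : A -> B) : Prop :=
  [/\ forall x y, h (meet x y) = meet (h x) (h y),
      forall x y, h (join x y) = join (h x) (h y)
    & forall x, h (neg x) = neg (h x)].

Inductive formula : Type :=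
  | Var of nat
  | And of formula & formula
  | Or of formula & formula
  | Neg of formula.

Definition formula_algebra : algebra :=
  @Algebra formula And Or Neg (inhabits (Var 0)).

Definition consequence : Type := set formula -> formula -> Prop.

Definition valid (M : structure) : consequence := fun Gamma phi =>
  forall v : formula_algebra -> M, is_hom v ->
    v @` Gamma `<=` designated M -> designated M (v phi).

Definition determined_by (K : set structure) : consequence := fun Gamma phi =>
  forall M, K M -> valid M Gamma phi.

Definition complete_wrt (L : consequence) (K : set structure) : Prop :=
  forall Gamma phi, L Gamma phi <-> determined_by K Gamma phi.

(* Substitutions are the endomorphisms of the formula algebra. *)
Record is_logic (L : consequence) : Prop := IsLogic {
  logic_refl : forall Gamma phi, Gamma phi -> L Gamma phi;
  logic_mono : forall Gamma Delta phi,
    Gamma `<=` Delta -> L Gamma phi -> L Delta phi;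
  logic_cut : forall Gamma Delta phi,
    (forall psi, Delta psi -> L Gamma psi) -> L Delta phi -> L Gamma phi;
  logic_subst : forall (s : formula_algebra -> formula_algebra) Gamma phi,
    is_hom s -> L Gamma phi -> L (s @` Gamma) (s phi)
}.

Definition extends (L L' : consequence) : Prop :=
  forall Gamma phi, L' Gamma phi -> L Gamma phi.

Definition extension_by (L R : consequence) : consequence := fun Gamma phi =>
  forall L', is_logic L' -> extends L' L -> extends L' R -> L' Gamma phi.

Definition finitary (L : consequence) : Prop :=
  forall Gamma phi, L Gamma phi ->
    exists Gamma0, [/\ Gamma0 `<=` Gamma, finite_set Gamma0 & L Gamma0 phi].

Definition PCP (L : consequence) : Prop :=
  forall Gamma phi1 phi2 psi,
    L (Gamma `|` [set phi1]) psi -> L (Gamma `|` [set phi2]) psi ->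
    L (Gamma `|` [set Or phi1 phi2]) psi.

Definition finite_structure (M : structure) : Prop := finite_set [set: M].

Definition finitely_generated (L : consequence) : Prop :=
  exists K : set structure,
    [/\ finite_set K, forall M, K M -> finite_structure M & complete_wrt L K].

Record is_demorgan_lattice (A : algebra) : Prop := IsDeMorganLattice {
  dm_meetC : forall x y : A, meet x y = meet y x;
  dm_joinC : forall x y : A, join x y = join y x;
  dm_meetA : forall x y z : A, meet x (meet y z) = meet (meet x y) z;
  dm_joinA : forall x y z : A, join x (join y z) = join (join x y) z;
  dm_meetK : forall x y : A, meet x (join x y) = x;
  dm_joinK : forall x y : A, join x (meet x y) = x;
  dm_meetDr : forall x y z : A, meet x (join y z) = join (meet x y) (meet x z);
  dm_negK : forall x : A, neg (neg x) = x;
  dm_neg_meet : forall x y : A, neg (meet x y) = join (neg x) (neg y);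
  dm_neg_join : forall x y : A, neg (join x y) = meet (neg x) (neg y)
}.

Definition lat_le (A : algebra) (x y : A) : Prop := meet x y = x.

Definition is_upset (A : algebra) (F : set A) : Prop :=
  forall x y, F x -> lat_le x y -> F y.

Definition BD_infty : consequence :=
  determined_by
    [set M : structure | is_demorgan_lattice M /\ is_upset (designated M)].

(* Conjunction of a list; the value on the empty list is irrelevant, as the
   lists below are non-empty for n >= 1. *)
Definition bigAnd (s : seq formula) : formula :=
  if s is phi :: s' then foldl And phi s' else Var 0.

(* The variables x_1, ..., x_{n+1} are Var 0, ..., Var n. *)
Definition BD_rule_premises (n : nat) : set formula :=
  [set bigAnd [seq Var j | j <- iota 0 n.+1 & j != i] | i in [set i | i < n.+1]].

Definition BD_rule_conclusion (n : nat) : formula :=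
  bigAnd [seq Var j | j <- iota 0 n.+1].

Definition BD (n : nat) : consequence :=
  extension_by BD_infty (fun Gamma phi =>
    Gamma = BD_rule_premises n /\ phi = BD_rule_conclusion n).

Inductive dm1 : Type := dm_f | dm_n | dm_b | dm_t.

Definition dm1_meet (x y : dm1) : dm1 :=
  match x, y with
  | dm_t, z | z, dm_t => z
  | dm_n, dm_n => dm_n
  | dm_b, dm_b => dm_b
  | _, _ => dm_f
  end.

Definition dm1_join (x y : dm1) : dm1 :=
  match x, y with
  | dm_f, z | z, dm_f => z
  | dm_n, dm_n => dm_n
  | dm_b, dm_b => dm_b
  | _, _ => dm_t
  end.

Definition dm1_neg (x : dm1) : dm1 :=
  match x with
  | dm_f => dm_t
  | dm_n => dm_n
  | dm_b => dm_b
  | dm_t => dm_f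
  end.

(* The coordinates 0, ..., n-1. The types 'I_n, n.-tuple T and {ffun 'I_n -> T}
   live in a universe too large for a carrier as soon as one speaks about sets
   of structures; this copy of 'I_n lives in Set. *)
Definition coord (n : nat) : Set := {i : nat | i < n}.

Definition DM_alg (n : nat) : algebra :=
  @Algebra (coord n -> dm1)
    (fun x y i => dm1_meet (x i) (y i))
    (fun x y i => dm1_join (x i) (y i))
    (fun x i => dm1_neg (x i))
    (inhabits (fun=> dm_t)).

Definition DM (n : nat) : structure :=
  @Structure (DM_alg n)
    [set x : coord n -> dm1 | exists i, x i = dm_t \/ x i = dm_b].

Record is_subuniverse (A : algebra) (S : set A) : Prop := IsSubuniverse {
  sub_meet : forall x y, S x -> S y -> S (meet x y);
  sub_join : forall x y, S x -> S y -> S (join x y);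
  sub_neg : forall x, S x -> S (neg x);
  sub_nonempty : inhabited {x : A | S x}
}.

Definition subalgebra (A : algebra) (S : set A) (HS : is_subuniverse S) : algebra :=
  @Algebra {x : A | S x}
    (fun x y => exist _ (meet (sval x) (sval y))
                  (sub_meet HS (proj2_sig x) (proj2_sig y)))
    (fun x y => exist _ (join (sval x) (sval y))
                  (sub_join HS (proj2_sig x) (proj2_sig y)))
    (fun x => exist _ (neg (sval x)) (sub_neg HS (proj2_sig x)))
    (sub_nonempty HS).

Definition substructure (M : structure) (S : set M) (HS : is_subuniverse S) :
    structure :=
  @Structure (subalgebra HS) [set x : {x : M | S x} | designated M (sval x)].

Definition is_substructure (N M : structure) : Prop :=
  exists (S : set M) (HS : is_subuniverse S), N = substructure HS.

Definition is_bigmeet (A : algebra) (X : set A) (m : A) : Prop :=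
  (forall x, X x -> lat_le m x) /\
  (forall z, (forall x, X x -> lat_le z x) -> lat_le z m).

(* In a lattice the meet of a non-empty finite subset exists and is unique, so
   quantifying over all m with is_bigmeet X m amounts to naming it. *)
Definition is_nfilter (n : nat) (A : algebra) (F : set A) : Prop :=
  is_upset F /\
  forall Y : set A, finite_set Y -> Y !=set0 ->
    (forall X : set A, X !=set0 -> X `<=` Y -> (X #<= `I_n)%card ->
       forall m, is_bigmeet X m -> F m) ->
    forall m, is_bigmeet Y m -> F m.

Definition is_prime_nfilter (n : nat) (A : algebra) (F : set A) : Prop :=
  is_nfilter n F /\ forall x y, F (join x y) -> F x \/ F y.

Definition finitary_PCP_extension (n : nat) (L : consequence) : Prop :=
  [/\ finitary L, extends L (BD n) & PCP L].

Definition complete_substructures (n : nat) (L : consequence) : Prop :=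
  exists K : set structure,
    (forall M, K M -> is_substructure M (DM n)) /\ complete_wrt L K.

Definition complete_prime_nfilters (n : nat) (L : consequence) : Prop :=
  exists K : set structure,
    [/\ finite_set K,
        forall M, K M ->
          [/\ finite_structure M, is_demorgan_lattice M
            & is_prime_nfilter n (designated M)]
      & complete_wrt L K].

(* Main.v *)
Require Import Defs.
From mathcomp Require Import all_boot.
From mathcomp Require Import boolp classical_sets functions cardinality.

(** Given (i), a non-derivable rule is separated by a prime theory T closed
under the rule of BD_n. Choose a longest family x_1, ..., x_k in T whose pairwise meets lie
outside T; the rule of BD_n forces k <= n, and by maximality each set
F_i = {phi | phi /\ x_i in T} is a prime filter while T is the union of the
F_i. The pairs of truth values (phi in F_i, ~phi in F_i) then define a
homomorphism from the formulas into DM_n whose designated preimage is T, and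
its range is a substructure of DM_n validating the logic. (ii) implies (iii)
because DM_n is finite and Q_n restricts to a prime n-filter. Under (iii),
primeness yields the PCP, the n-filter condition yields the rule of BD_n, and
finitarity is a compactness argument over countably many variables and finitely
many values. *)

Set Implicit Arguments.
Unset Strict Implicit.
Unset Printing Implicit Defensive.

Local Open Scope classical_set_scope.

(** * Lattice order and finite meets *)

Section DeMorganOrder.
Variables (A : algebra) (dmA : is_demorgan_lattice A).
Implicit Types x y z : A.

Lemma lat_le_refl x : lat_le x x.
Proof. by rewrite /lat_le -{2}(dm_joinK dmA x x) (dm_meetK dmA). Qed.

Lemma lat_le_trans x y z : lat_le x y -> lat_le y z -> lat_le x z.
Proof. by rewrite /lat_le => xy yz; rewrite -xy -(dm_meetA dmA) yz. Qed.

Lemma lat_leIl x y : lat_le (meet x y) x.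
Proof.
by rewrite /lat_le (dm_meetC dmA) (dm_meetA dmA) (lat_le_refl x).
Qed.

Lemma lat_leIr x y : lat_le (meet x y) y.
Proof. by rewrite (dm_meetC dmA); exact: lat_leIl. Qed.

Lemma lat_lexI x y z : lat_le z x -> lat_le z y -> lat_le z (meet x y).
Proof. by rewrite /lat_le => zx zy; rewrite (dm_meetA dmA) zx zy. Qed.

Lemma lat_leUl x y : lat_le x (join x y).
Proof. exact: dm_meetK. Qed.

Lemma lat_leUr x y : lat_le y (join x y).
Proof. by rewrite (dm_joinC dmA); exact: lat_leUl. Qed.

(** The last clause lets any property stable under binary meets pass from the members of [X] to
    their meet. *)
Lemma finite_bigmeet (X : set A) : finite_set X -> X !=set0 ->
  exists m, is_bigmeet X m /\
    forall P : set A, (forall x y, P x -> P y -> P (meet x y)) ->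
      X `<=` P -> P m.
Proof.
move=> /(@finite_seqP {classic A})[s ->].
elim: s => [[x //]|a [_ _|b s IH _]].
  exists a; split; last by move=> P _; apply => /=; exact: mem_head.
  split=> [x|z]; first by rewrite /= inE => /eqP ->; exact: lat_le_refl.
  by apply => /=; exact: mem_head.
have [|m [[mle mge] mP]] := IH; first by exists b => /=; exact: mem_head.
exists (meet a m); split.
  split=> [x /=|z zle].
    rewrite in_cons => /orP[/eqP ->|xs]; first exact: lat_leIl.
    exact: lat_le_trans (lat_leIr _ _) (mle _ xs).
  apply: lat_lexI; first by apply: zle => /=; exact: mem_head.
  by apply: mge => x xs; apply: zle; rewrite /= in_cons xs orbT.
move=> P PI sP; apply: (PI); first by apply: sP => /=; exact: mem_head.
by apply: mP => // x xs; apply: sP; rewrite /= in_cons xs orbT.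
Qed.

End DeMorganOrder.

(** * Valuations and finite conjunctions *)

Lemma is_hom_comp (A B C : algebra) (g : B -> C) (f : A -> B) :
  is_hom g -> is_hom f -> is_hom (g \o f).
Proof.
move=> [gm gj gn] [fm fj fn].
by split=> *; rewrite /= ?(fm, fj, fn) ?(gm, gj, gn).
Qed.

Fixpoint eval (A : algebra) (f : nat -> A) (phi : formula) : A :=
  match phi with
  | Var i => f i
  | And a b => meet (eval f a) (eval f b)
  | Or a b => join (eval f a) (eval f b)
  | Neg a => neg (eval f a)
  end.

Lemma eval_hom (A : algebra) (f : nat -> A) :
  @is_hom formula_algebra A (eval f).
Proof. by []. Qed.

Lemma homE (A : algebra) (v : formula_algebra -> A) : is_hom v ->
  v = eval (fun i => v (Var i)).
Proof.
move=> [vm vj vn]; apply/funext; elim=> //= [a IHa b IHb|a IHa b IHb|a IHa].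
- by rewrite -IHa -IHb -vm.
- by rewrite -IHa -IHb -vj.
- by rewrite -IHa -vn.
Qed.

Fixpoint var_bound (phi : formula) : nat :=
  match phi with
  | Var i => i.+1
  | And a b | Or a b => maxn (var_bound a) (var_bound b)
  | Neg a => var_bound a
  end.

Lemma eq_eval (A : algebra) (f g : nat -> A) phi :
  (forall i, i < var_bound phi -> f i = g i) -> eval f phi = eval g phi.
Proof.
elim: phi => [i|a IHa b IHb|a IHa b IHb|a IHa] fg /=.
- exact: fg (leqnn _).
- by rewrite IHa ?IHb // => i ib; apply: fg; rewrite /= leq_max ib ?orbT.
- by rewrite IHa ?IHb // => i ib; apply: fg; rewrite /= leq_max ib ?orbT.
- by rewrite IHa.
Qed.

(** The universal property of meets hides the bracketing of [foldl]; non-emptiness excludes the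
    default [Var 0]. *)
Lemma le_bigAnd (A : algebra) (v : formula_algebra -> A) (l : seq nat) (z : A) :
    is_demorgan_lattice A -> is_hom v -> l != [::] ->
  lat_le z (v (bigAnd [seq Var j | j <- l])) <->
  forall j, j \in l -> lat_le z (v (Var j)).
Proof.
move=> dmA [vm _ _]; case: l => [//|a l _] /=.
have aux phi : lat_le z (v (foldl And phi [seq Var j | j <- l])) <->
    lat_le z (v phi) /\ forall j, j \in l -> lat_le z (v (Var j)).
  elim: l phi => [|b l IH] phi /=; first by split=> [|[]].
  rewrite IH (vm phi (Var b)); split=> [[zI zl]|[zphi zl]].
    split; first exact: lat_le_trans zI (lat_leIl _ _ _).
    move=> j; rewrite in_cons => /orP[/eqP ->|]; last exact: zl.
    exact: lat_le_trans zI (lat_leIr _ _ _).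
  split; last by move=> j jl; apply: zl; rewrite in_cons jl orbT.
  by apply: lat_lexI => //; apply: zl; exact: mem_head.
rewrite aux; split=> [[za zl] j|zl].
  by rewrite in_cons => /orP[/eqP ->//|]; exact: zl.
split; first by apply: zl; exact: mem_head.
by move=> j jl; apply: zl; rewrite in_cons jl orbT.
Qed.

Lemma mem_iota_filter n i j :
  (j \in [seq j <- iota 0 n.+1 | j != i]) = (j != i) && (j < n.+1).
Proof. by rewrite mem_filter mem_iota. Qed.

Lemma iota_filter_neq0 n i : 0 < n -> [seq j <- iota 0 n.+1 | j != i] != [::].
Proof.
move=> n0; apply/eqP => s0.
(* The boolean [i == 0], read as a number, is 0 or 1 and differs from [i]; it is an index because
   [n] is positive. *)
have := mem_iota_filter n i (i == 0); rewrite s0 in_nil => /esym.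
by case: i {s0} => [|i]; rewrite /= ?ltnS ?n0.
Qed.

(** * Inequalities valid in all De Morgan lattices *)

Definition fle (phi psi : formula) : Prop :=
  forall A : algebra, is_demorgan_lattice A ->
  forall v : formula_algebra -> A, is_hom v -> lat_le (v phi) (v psi).

Lemma fle_trans phi psi chi : fle phi psi -> fle psi chi -> fle phi chi.
Proof.
by move=> h1 h2 A dmA v hv; apply: lat_le_trans (h1 _ _ _ hv) (h2 _ _ _ hv).
Qed.

Lemma fle_BD_infty phi psi : fle phi psi -> BD_infty [set phi] psi.
Proof.
move=> le M [dmM upM] v hv vphi; apply: upM (le _ dmM v hv).
by apply: vphi; exists phi.
Qed.

Lemma fleIl phi psi : fle (And phi psi) phi.
Proof. by move=> A dmA v [vm _ _]; rewrite (vm phi psi); exact: lat_leIl. Qed.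

Lemma fleIr phi psi : fle (And phi psi) psi.
Proof. by move=> A dmA v [vm _ _]; rewrite (vm phi psi); exact: lat_leIr. Qed.

Lemma fle_xI phi psi chi : fle chi phi -> fle chi psi -> fle chi (And phi psi).
Proof.
move=> h1 h2 A dmA v hv; have [vm _ _] := hv; rewrite (vm phi psi).
by apply: lat_lexI => //; [exact: h1|exact: h2].
Qed.

Lemma fleUl phi psi : fle phi (Or phi psi).
Proof. by move=> A dmA v [_ vj _]; rewrite (vj phi psi); exact: lat_leUl. Qed.

Lemma fleUr phi psi : fle psi (Or phi psi).
Proof. by move=> A dmA v [_ vj _]; rewrite (vj phi psi); exact: lat_leUr. Qed.

Lemma fle_refl phi : fle phi phi.
Proof. by move=> A dmA v hv; exact: lat_le_refl. Qed.

Lemma fle_distr phi psi chi :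
  fle (And chi (Or phi psi)) (Or (And chi phi) (And chi psi)).
Proof.
move=> A dmA v [vm vj _].
rewrite (vm chi (Or phi psi)) (vj phi psi) (vj (And chi phi) (And chi psi)).
rewrite (vm chi phi) (vm chi psi) (dm_meetDr dmA); exact: lat_le_refl.
Qed.

Lemma fle_negneg phi : fle (Neg (Neg phi)) phi /\ fle phi (Neg (Neg phi)).
Proof.
split=> A dmA v [_ _ vn]; rewrite (vn (Neg phi)) (vn phi) (dm_negK dmA);
  exact: lat_le_refl.
Qed.

Lemma fle_negI phi psi :
  fle (Neg (And phi psi)) (Or (Neg phi) (Neg psi)) /\
  fle (Or (Neg phi) (Neg psi)) (Neg (And phi psi)).
Proof.
split=> A dmA v [vm vj vn]; rewrite (vn (And phi psi)) (vm phi psi)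
  (vj (Neg phi) (Neg psi)) (vn phi) (vn psi) (dm_neg_meet dmA);
  exact: lat_le_refl.
Qed.

Lemma fle_negU phi psi :
  fle (Neg (Or phi psi)) (And (Neg phi) (Neg psi)) /\
  fle (And (Neg phi) (Neg psi)) (Neg (Or phi psi)).
Proof.
split=> A dmA v [vm vj vn]; rewrite (vn (Or phi psi)) (vj phi psi)
  (vm (Neg phi) (Neg psi)) (vn phi) (vn psi) (dm_neg_join dmA);
  exact: lat_le_refl.
Qed.

(** * Prime filters of formulas as four-valued valuations *)

(* The empty set and the set of all formulas are allowed: they correspond to
   the constant valuations n and b. *)
Record prime_filter (F : set formula) : Prop := PrimeFilter {
  pf_up : forall phi psi, fle phi psi -> F phi -> F psi;
  pf_meet : forall phi psi, F phi -> F psi -> F (And phi psi);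
  pf_prime : forall phi psi, F (Or phi psi) -> F phi \/ F psi
}.

(** The Belnap reading: [x] says that a formula is asserted, [y] that its negation is; [dm_b] is
    both and [dm_n] neither. *)
Definition dm_of (x y : bool) : dm1 :=
  if x then (if y then dm_b else dm_t) else (if y then dm_f else dm_n).

Definition prime_val (F : set formula) (phi : formula) : dm1 :=
  dm_of `[< F phi >] `[< F (Neg phi) >].

Lemma prime_val_designated F phi :
  (prime_val F phi = dm_t \/ prime_val F phi = dm_b) <-> F phi.
Proof.
by split=> [[]|]; rewrite /prime_val; case: asboolP => //; case: asbool => //=;
  auto.
Qed.

Section PrimeValHom.
Variables (F : set formula) (pF : prime_filter F).

Let FI phi psi : `[< F (And phi psi) >] = `[< F phi >] && `[< F psi >].
Proof.
apply/asboolP/andP => [FI|[/asboolP f1 /asboolP f2]]; last exact: pf_meet.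
by split; apply/asboolP; apply: (pf_up pF) FI; [exact: fleIl|exact: fleIr].
Qed.

Let FU phi psi : `[< F (Or phi psi) >] = `[< F phi >] || `[< F psi >].
Proof.
apply/asboolP/orP => [/(pf_prime pF)[?|?]|[]/asboolP].
- by left; apply/asboolP.
- by right; apply/asboolP.
- exact: (pf_up pF) (fleUl _ _).
- exact: (pf_up pF) (fleUr _ _).
Qed.

Let Feq phi psi : fle phi psi /\ fle psi phi -> `[< F phi >] = `[< F psi >].
Proof. by case=> h1 h2; apply: asbool_equiv_eq; split; exact: pf_up. Qed.

Lemma prime_val_meet phi psi :
  prime_val F (And phi psi) = dm1_meet (prime_val F phi) (prime_val F psi).
Proof.
rewrite /prime_val FI (Feq (fle_negI phi psi)) FU.
by do 4 case: asbool.
Qed.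

Lemma prime_val_join phi psi :
  prime_val F (Or phi psi) = dm1_join (prime_val F phi) (prime_val F psi).
Proof.
rewrite /prime_val FU (Feq (fle_negU phi psi)) FI.
by do 4 case: asbool.
Qed.

Lemma prime_val_neg phi : prime_val F (Neg phi) = dm1_neg (prime_val F phi).
Proof.
rewrite /prime_val (Feq (fle_negneg phi)).
by do 2 case: asbool.
Qed.

End PrimeValHom.

(** * Prime theories closed under the rule of BD_n as unions of n prime filters *)

Definition bigOr (x : nat -> formula) (l : seq nat) : formula :=
  if l is a :: l' then foldr (fun j phi => Or (x j) phi) (x a) l' else Var 0.

Lemma fle_bigOr x l j : j \in l -> fle (x j) (bigOr x l).
Proof.
case: l => [//|a l] /=; elim: l => [|b l IH] /=.
  by rewrite inE => /eqP ->; exact: fle_refl.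
(* The outermost disjunct is [x b], with [x a] innermost, so [b] is split off first. *)
rewrite !in_cons orbCA => /orP[/eqP ->|jl]; first exact: fleUl.
by apply: fle_trans (IH _) (fleUr _ _); rewrite in_cons.
Qed.

Section UnionOfPrimeFilters.
Variables (n : nat) (T : set formula).
Hypotheses (n_gt0 : 0 < n)
  (T_up : forall phi psi, fle phi psi -> T phi -> T psi)
  (T_prime : forall phi psi, T (Or phi psi) -> T phi \/ T psi)
  (T_rule : forall y : nat -> formula_algebra,
     (forall i, i < n.+1 ->
        T (eval y (bigAnd [seq Var j | j <- iota 0 n.+1 & j != i]))) ->
     T (eval y (BD_rule_conclusion n))).

(* Disjointness is relative to T: the complement of T plays the role of 0. *)
Definition disjoint_family (k : nat) (x : nat -> formula) : Prop :=
  (forall i, i < k -> T (x i)) /\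
  (forall i j, i < k -> j < k -> i != j -> ~ T (And (x i) (x j))).

(** Distributivity moves [z] into the disjunction, and primeness of [T] selects a disjunct. *)
Let T_bigOr z x l : l != [::] -> T (And z (bigOr x l)) ->
  exists2 j, j \in l & T (And z (x j)).
Proof.
case: l => [//|a l _] /=; elim: l => [|b l IH] /=.
  by exists a => //; exact: mem_head.
move=> /(T_up (@fle_distr _ _ _))/T_prime[Tb|/IH[j]].
  by exists b => //; rewrite !inE eqxx orbT.
by rewrite in_cons => jl Tj; exists j => //; rewrite !in_cons orbCA jl orbT.
Qed.

(* With y_i the join of the x_j for j <> i, each x_i lies below the i-th
   premise of the rule of BD_n, so its conclusion z is in T. Splitting z below
   y_0 into joinands, and then one of them below the corresponding y_j, yields
   x_j /\ x_k in T with j <> k. *)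
Lemma disjoint_family_bound k x : disjoint_family k x -> k <= n.
Proof.
move=> [Tx disj]; rewrite leqNgt; apply/negP => nk.
pose l i := [seq j <- iota 0 n.+1 | j != i].
have l0 i : l i != [::] by exact: iota_filter_neq0.
pose y i : formula_algebra := bigOr x (l i).
have inl i j : i < n.+1 -> j \in l i -> [/\ i < k, j < k & i != j].
  rewrite mem_iota_filter eq_sym => /leq_trans ik /andP[-> /leq_trans jk].
  by split=> //; [exact: ik|exact: jk].
have Tz : T (eval y (BD_rule_conclusion n)).
  apply: T_rule => i ilt; apply: T_up (Tx i (leq_trans ilt nk)).
  move=> A dmA v hv; have h := is_hom_comp hv (eval_hom y).
  apply/(le_bigAnd _ dmA h (l0 i)) => j; rewrite mem_iota_filter.
  move=> /andP[ji jn].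
  by apply: fle_bigOr => //; rewrite mem_iota_filter eq_sym ji.
have zy i : i < n.+1 -> fle (eval y (BD_rule_conclusion n)) (y i).
  move=> ilt A dmA v hv; have h := is_hom_comp hv (eval_hom y).
  have /(le_bigAnd _ dmA h) := lat_le_refl dmA
    ((v \o eval y) (bigAnd [seq Var j | j <- iota 0 n.+1])).
  by apply => //; rewrite mem_iota.
have := T_up (fle_xI (@fle_refl _) (zy 0 (ltn0Sn _))) Tz.
move=> /(T_bigOr (l0 0))[j jl Tj].
have [_ jk _] := inl 0 j (ltn0Sn _) jl.
have jn : j < n.+1 by move: jl; rewrite mem_iota_filter => /andP[].
have := T_up (fle_xI (@fleIr _ _) (fle_trans (@fleIl _ _) (zy j jn))) Tj.
by move=> /(T_bigOr (l0 j))[i /(inl _ _ jn)[] *]; exact: (disj j i).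
Qed.

(* For a disjoint family of maximal length: if a, b are in F_i but a /\ b is
   not, then a /\ x_i and b /\ x_i can replace x_i, giving a longer family. *)
Lemma prime_filters_cover : exists F : nat -> set formula,
  (forall i, prime_filter (F i)) /\
  forall phi, T phi <-> exists2 i, i < n & F i phi.
Proof.
pose P k := `[< exists x, disjoint_family k x >].
(* The empty family starts the search for a maximal length, and [n] bounds it. *)
have exP : exists k, P k.
  by exists 0; apply/asboolP; exists (fun=> Var 0); split.
have Pn k : P k -> k <= n by move=> /asboolP[x]; exact: disjoint_family_bound.
case: (ex_maxnP exP Pn) => k Pk maxk.
have {}maxk x : ~ disjoint_family k.+1 x.
  by move=> ax; have /maxk := asboolT (ex_intro _ x ax); rewrite ltnn.
have kn := Pn _ Pk; move/asboolP: Pk => [x [Tx disj]].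
have TC phi psi : T (And phi psi) -> T (And psi phi).
  by apply: T_up; apply: fle_xI; [exact: fleIr|exact: fleIl].
(* The guard makes the sets with index at least [k] empty, which still counts as prime filters, so
   exactly [n] indices can be used. *)
exists (fun i phi => i < k /\ T (And phi (x i))); split.
  move=> i; split.
  - move=> phi psi le [ik Ti]; split=> //; apply: T_up Ti.
    by apply: fle_xI (@fleIr _ _); apply: fle_trans (@fleIl _ _) le.
  - move=> phi psi [ik T1] [_ T2]; split=> //; apply: contrapT => nT.
    (* [And phi (x i)] takes the place of [x i], and [And psi (x i)] is appended at position [k]. *)
    pose x' j := if j == i then And phi (x i) else
                 if j == k then And psi (x i) else x j.
    have ki : (k == i) = false by rewrite gtn_eqF.
    have x'i : x' i = And phi (x i) by rewrite /x' eqxx.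
    have x'k : x' k = And psi (x i) by rewrite /x' ki eqxx.
    have x'j j : j < k -> j != i -> x' j = x j.
      by move=> jk ji; rewrite /x' (negbTE ji) ltn_eqF.
    have nik : ~ T (And (x' i) (x' k)).
      rewrite x'i x'k => h; apply: nT; apply: T_up h.
      apply: fle_xI; last exact: fle_trans (@fleIl _ _) (@fleIr _ _).
      apply: fle_xI; first exact: fle_trans (@fleIl _ _) (@fleIl _ _).
      exact: fle_trans (@fleIr _ _) (@fleIl _ _).
    have nij j a : j < k -> j != i -> ~ T (And (And a (x i)) (x j)).
      move=> jk ji h; apply: (disj i j) => //; first by rewrite eq_sym.
      apply: T_up h; apply: fle_xI (@fleIr _ _).
      exact: fle_trans (@fleIl _ _) (@fleIr _ _).
    apply: (maxk x'); split=> [j|j1 j2].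
      rewrite ltnS leq_eqVlt => /orP[/eqP ->|jk]; first by rewrite x'k.
      by have [->|ji] := eqVneq j i; rewrite ?x'i // x'j //; exact: Tx.
    (* Disjointness is symmetric, so only the larger index can be the new one [k]. *)
    wlog j12 : j1 j2 / j1 < j2.
      move=> wl h1 h2 h12; move: (h12); rewrite neq_ltn => /orP[] lt.
        exact: wl.
      by move=> /TC; apply: wl => //; rewrite eq_sym.
    move=> _; rewrite ltnS leq_eqVlt => /orP[/eqP j2k _|j2k _].
      move: j12; rewrite j2k => j1k.
      have [->//|j1i] := eqVneq j1 i.
      by rewrite x'k x'j // => /TC; exact: nij.
    have j1k := ltn_trans j12 j2k.
    have [j1i|j1i] := eqVneq j1 i.
      have j2i : j2 != i by rewrite -j1i gtn_eqF.
      by rewrite j1i x'i (x'j j2) //; exact: nij.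
    rewrite (x'j j1) //; have [->|j2i] := eqVneq j2 i.
      by rewrite x'i => /TC; exact: nij.
    by rewrite x'j //; apply: disj => //; rewrite ltn_eqF.
  - move=> phi psi [ik /TC/(T_up (@fle_distr _ _ _))/T_prime[]/TC h].
      by left.
    by right.
move=> phi; split=> [Tphi|[i _ [_]]]; last exact: T_up (@fleIl _ _).
(* A formula of [T] outside every [F i] is disjoint from each [x i] and could be appended to the
   family. *)
apply: contrapT => nF.
have nphi i : i < k -> ~ T (And phi (x i)).
  by move=> ik h; apply: nF; exists i => //; exact: leq_trans kn.
apply: (maxk (fun j => if j == k then phi else x j)); split=> [j|j1 j2].
  rewrite ltnS leq_eqVlt; have [//|_ /= jk] := eqVneq j k; exact: Tx.
rewrite !ltnS (leq_eqVlt j1) (leq_eqVlt j2).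
have [->|j1k] := eqVneq j1 k; have [->|j2k] := eqVneq j2 k => //=.
- by move=> _ jk _; exact: nphi.
- by move=> jk _ _ /TC; exact: nphi.
- exact: disj.
Qed.

End UnionOfPrimeFilters.

(** * Separation by prime theories and the canonical substructure, from (i) to (ii) *)

Section Logics.
Variable L : consequence.
Hypothesis logicL : is_logic L.

(** Zorn's lemma gives a maximal set of additional premises not yielding [phi]: finitarity handles
    unions of chains, and the PCP makes the resulting theory prime. *)
Lemma prime_theory_separation Gamma phi :
    finitary L -> PCP L -> ~ L Gamma phi ->
  exists T : set formula, [/\ Gamma `<=` T, ~ T phi,
    forall psi, L T psi -> T psi
    & forall a b, T (Or a b) -> T a \/ T b].
Proof.
move=> finL pcpL nphi.
pose P := [set X | ~ L (Gamma `|` X) phi].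
have [F FP chain|X [PX maxX]] := @Zorn_bigcup formula P.
  move=> /finL[G0 [+ /(@finite_seqP {classic formula})[s G0s]]]; rewrite {}G0s.
  move=> sF Ls.
  (* The finitely many premises used lie in [Gamma] and a single member of the chain; [set0] covers
     the case where the chain contributes nothing. *)
  have [X [FX sX]] : exists X, (F X \/ X = set0) /\ [set` s] `<=` Gamma `|` X.
    elim: s sF {Ls} => [_|a s IH sF]; first by exists set0; split; [right|].
    have [|X [FX sX]] := IH.
      by move=> x xs; apply: sF; rewrite /= in_cons xs orbT.
    have [Ga|[Y FY Ya]] := sF a (mem_head _ _).
      exists X; split=> // x /=; rewrite in_cons => /orP[/eqP ->|/sX//].
      by left.
    have [YX|XY] : Y `<=` X \/ X `<=` Y.
      case: FX => [FX|->]; first exact: chain.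
      by right; exact: sub0set.
      exists X; split=> // x /=; rewrite in_cons => /orP[/eqP ->|/sX//].
      by right; exact: YX.
    exists Y; split; [by left|move=> x /=].
    rewrite in_cons => /orP[/eqP ->|/sX[Gx|Xx]]; [by right|by left|].
    by right; exact: XY.
  have : ~ L (Gamma `|` X) phi by case: FX => [/FP//|->]; rewrite setU0.
  by apply; exact: logic_mono sX Ls.
have sT : Gamma `|` X `<=` L (Gamma `|` X) by move=> ?; exact: logic_refl.
exists (L (Gamma `|` X)); split=> // [psi Gpsi|psi|a b Tab].
- by apply: sT; left.
- exact: logic_cut.
- apply: contrapT => /not_orP[na nb]; apply: PX.
  (* By maximality, adding any formula outside the theory makes [phi] derivable. *)
  have add c : ~ L (Gamma `|` X) c -> L ((Gamma `|` X) `|` [set c]) phi.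
    move=> nc; apply: contrapT; rewrite -setUA; apply: maxX.
    split; first exact: subsetUl.
    by move=> /(_ c (or_intror erefl)) Xc; apply: nc; apply: sT; right.
  apply: (logic_cut logicL) (pcpL _ _ _ _ (add _ na) (add _ nb)) => psi.
  by case=> [/sT//|->].
Qed.

Lemma fle_closed (T : set formula) phi psi : extends L BD_infty ->
  (forall chi, L T chi -> T chi) -> fle phi psi -> T phi -> T psi.
Proof.
move=> extL Tcl le Tphi; apply: Tcl.
apply: (logic_mono logicL) (extL _ _ (fle_BD_infty le)) => _ ->.
exact: Tphi.
Qed.

Lemma BD_rule_closed n (T : set formula) (y : nat -> formula_algebra) :
    extends L (BD n) -> (forall chi, L T chi -> T chi) ->
    (forall i, i < n.+1 ->
       T (eval y (bigAnd [seq Var j | j <- iota 0 n.+1 & j != i]))) ->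
  T (eval y (BD_rule_conclusion n)).
Proof.
move=> extL Tcl prem; apply: Tcl.
have /extL/(logic_subst logicL (eval_hom y)) :
    BD n (BD_rule_premises n) (BD_rule_conclusion n).
  by move=> L' _ _; apply.
apply: (logic_mono logicL) => _ [_ [i ilt <-] <-]; exact: prem.
Qed.

Lemma substructures_of_PCP n : 0 < n -> extends L BD_infty ->
  finitary_PCP_extension n L -> complete_substructures n L.
Proof.
move=> n0 extL [finL extn pcpL].
(* Taking every substructure that validates [L] makes soundness immediate; only completeness
   remains. *)
exists [set M | is_substructure M (DM n) /\
          forall Gamma phi, L Gamma phi -> valid M Gamma phi].
split=> [M []//|Gamma phi]; split=> [LG M [_ LM]|det]; first exact: LM.
apply: contrapT => /(prime_theory_separation finL pcpL).
move=> [T [GT Tphi Tcl Tprime]]; apply: Tphi.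
have [F [pF TF]] := prime_filters_cover n0
  (fun a b => fle_closed extL Tcl) Tprime (fun y => BD_rule_closed extn Tcl).
pose h (psi : formula_algebra) : DM n := fun i => prime_val (F (sval i)) psi.
have hom_h : is_hom h.
  split=> *; apply/funext => i; rewrite /h /=.
  - exact: prime_val_meet.
  - exact: prime_val_join.
  - exact: prime_val_neg.
have hT psi : designated (DM n) (h psi) <-> T psi.
  rewrite TF; split=> [[[i ilt] /prime_val_designated Fi]|[i ilt Fi]].
    by exists i.
  by exists (exist _ i ilt); apply/prime_val_designated.
have [hm hj hn] := hom_h.
have subS : is_subuniverse (range h).
  split.
  - by move=> _ _ [a _ <-] [b _ <-]; exists (And a b).
  - by move=> _ _ [a _ <-] [b _ <-]; exists (Or a b).
  - by move=> _ [a _ <-]; exists (Neg a).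
  - by apply: inhabits; exists (h (Var 0)); exists (Var 0).
apply/hT.
pose h' (psi : formula_algebra) : substructure subS :=
  exist _ (h psi) (ex_intro2 _ _ psi I erefl).
have eqS (u w : substructure subS) : sval u = sval w -> u = w.
  by case: u w => [u pu] [w pw] /= uw; exact: eq_exist.
apply: (det (substructure subS) _ h').
- split; first by exists (range h), subS.
  move=> Delta psi LD v [vm vj vn] vD.
  (* Each value of [v] is [h] of some formula, so [v] factors as [h] after a substitution [s];
     substitution invariance of [L] then gives validity in the range. *)
  have /choice[s hs] : forall i, exists a, h a = sval (v (Var i)).
    by move=> i; have [a _ <-] := proj2_sig (v (Var i)); exists a.
  have hv chi : h (eval (s : nat -> formula_algebra) chi) = sval (v chi).
    elim: chi => [i|a IHa b IHb|a IHa b IHb|a IHa] /=.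
    + exact: hs.
    + by rewrite (hm (eval _ a)) IHa IHb (vm a b).
    + by rewrite (hj (eval _ a)) IHa IHb (vj a b).
    + by rewrite (hn (eval _ a)) IHa (vn a).
  rewrite /= -hv; apply/hT/Tcl.
  apply: (logic_mono logicL) (logic_subst logicL (eval_hom s) LD).
  move=> _ [chi Dchi <-]; apply/hT; rewrite hv.
  by apply: (vD (v chi)); exists chi.
- split=> [a b|a b|a]; apply: eqS => /=.
  + exact: hm.
  + exact: hj.
  + exact: hn.
- by move=> _ [psi Gpsi <-]; apply/hT; exact: GT.
Qed.

End Logics.

(** * Substructures of DM_n are finite prime n-filter structures, from (ii) to (iii) *)

Lemma DM_demorgan n : is_demorgan_lattice (DM n).
Proof.
split=> [x y|x y|x y z|x y z|x y|x y|x y z|x|x y|x y]; apply/funext => i /=.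
- by case: (x i); case: (y i).
- by case: (x i); case: (y i).
- by case: (x i); case: (y i); case: (z i).
- by case: (x i); case: (y i); case: (z i).
- by case: (x i); case: (y i).
- by case: (x i); case: (y i).
- by case: (x i); case: (y i); case: (z i).
- by case: (x i).
- by case: (x i); case: (y i).
- by case: (x i); case: (y i).
Qed.

Lemma subalgebra_demorgan (A : algebra) (S : set A) (HS : is_subuniverse S) :
  is_demorgan_lattice A -> is_demorgan_lattice (subalgebra HS).
Proof.
have eqS (u w : subalgebra HS) : sval u = sval w -> u = w.
  by case: u w => [u pu] [w pw] /= uw; exact: eq_exist.
case=> *; split; intros; apply: eqS => /=; auto.
Qed.

(** A parametrisation by a finite type, from which all finiteness claims about [DM n] follow. *)
Definition coords_of n (a : {ffun 'I_n -> bool * bool}) : DM n :=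
  fun i => dm_of (a (Ordinal (proj2_sig i))).1 (a (Ordinal (proj2_sig i))).2.

Lemma coords_of_surj n (x : DM n) : exists a, coords_of a = x.
Proof.
pose code y := match y with
  | dm_t => (true, false) | dm_b => (true, true)
  | dm_f => (false, true) | dm_n => (false, false) end.
exists [ffun i : 'I_n => code (x (exist _ (val i) (ltn_ord i)))].
apply/funext => -[i ilt]; rewrite /coords_of !ffunE /=.
by rewrite (bool_irrelevance (ltn_ord (Ordinal ilt)) ilt); case: (x _).
Qed.

Lemma finite_sub_DM n (S : set (DM n)) (HS : is_subuniverse S) :
  finite_structure (substructure HS).
Proof.
have [[x0 Sx0]] : inhabited {x | S x} := sub_nonempty HS.
(* Codes of tuples outside [S] go to the default [x0]. *)
pose g (a : {ffun 'I_n -> bool * bool}) : substructure HS :=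
  if pselect (S (coords_of a)) is left Sa then exist _ _ Sa else exist _ x0 Sx0.
apply: (@sub_finite_set _ _ (g @` setT)); last exact: finite_image.
move=> [x Sx] _; have [a ax] := coords_of_surj x; exists a => //.
rewrite /g; case: pselect => [Sa|]; last by rewrite ax.
exact: eq_exist.
Qed.

Lemma finite_substructures n (K : set structure) :
  (forall M, K M -> is_substructure M (DM n)) -> finite_set K.
Proof.
move=> KDM.
(* Every subuniverse is decoded from one of finitely many sets of codes, and proof irrelevance makes
   the substructure depend only on it. *)
pose f (B : {set {ffun 'I_n -> bool * bool}}) : set (DM n) :=
  [set x | exists2 a, a \in B & coords_of a = x].
pose g B : structure :=
  if pselect (is_subuniverse (f B)) is left HS then substructure HS else DM n.
apply: (@sub_finite_set _ _ (g @` setT)); last exact: finite_image.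
move=> _ /KDM[S [HS ->]]; exists [set a | `[< S (coords_of a) >]]%SET => //.
have fS : f [set a | `[< S (coords_of a) >]]%SET = S.
  apply/seteqP; split=> [_ [a + <-]|x Sx].
    by rewrite inE => /asboolP.
  have [a ax] := coords_of_surj x; exists a => //.
  by rewrite inE; apply/asboolP; rewrite ax.
rewrite /g fS; case: pselect => // HS'; congr substructure.
exact: Prop_irrelevance.
Qed.

(** This prime filter of the four-element lattice, tested at some coordinate, gives Q_n. *)
Definition designated1 (x : dm1) : Prop := x = dm_t \/ x = dm_b.

Lemma designated1_meet x y :
  designated1 (dm1_meet x y) <-> designated1 x /\ designated1 y.
Proof.
rewrite /designated1; split.
  by case: x; case: y => -[]//=; split; auto.
by case=> -[] -> [] -> /=; auto.
Qed.

Lemma designated1_join x y :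
  designated1 (dm1_join x y) <-> designated1 x \/ designated1 y.
Proof.
by rewrite /designated1; split; case: x; case: y => /=; intuition discriminate.
Qed.

Lemma designated1_le x y :
  dm1_meet x y = x -> designated1 x -> designated1 y.
Proof. by move=> <- /designated1_meet[]. Qed.

(* A meet of Y that is undesignated at each of the n coordinates has at each of
   them an undesignated member of Y; these members form the offending subset. *)
Lemma sub_DM_prime_nfilter n (S : set (DM n)) (HS : is_subuniverse S) :
  0 < n -> is_prime_nfilter n (designated (substructure HS)).
Proof.
move=> n0; have dmS := subalgebra_demorgan HS (DM_demorgan n).
have leE (u w : substructure HS) (i : coord n) : lat_le u w ->
    designated1 (sval u i) -> designated1 (sval w i).
  move=> uw; apply: designated1_le.
  by rewrite -[in RHS]uw.
split; first split.
- by move=> u w [i ui] uw; exists i; exact: leE ui.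
- move=> Y finY Y0 XF m [_ mge]; apply: contrapT => nm.
  have /choice[y yP] (i : coord n) :
      exists y, Y y /\ ~ designated1 (sval y i).
    apply: contrapT => /forallNP ny.
    (* If all of [Y] were designated at [i], so would be its meet, since designation at one
       coordinate is stable under meets. *)
    have [z [[zle _] zP]] := finite_bigmeet dmS finY Y0.
    apply: nm; exists i; apply: (leE z m); first exact: mge.
    apply: (zP [set x | designated1 (sval x i)]) => [u w ui wi|x Yx] /=.
      exact/designated1_meet.
    by apply: contrapT => xi; apply: (ny x).
  have cX : (range y #<= `I_n)%card.
    apply: card_le_trans (card_image_le _ _) _.
    have sval_inj : {in [set: coord n] &, injective sval}.
      by move=> [i ilt] [j jlt] _ _ /= ij; apply: eq_exist.
    rewrite -(card_le_eql (inj_card_eq sval_inj)).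
    by apply: subset_card_le => _ [[i ilt] _ <-].
  have X0 : range y !=set0 by exists (y (exist _ 0 n0)); exists (exist _ 0 n0).
  have YX : range y `<=` Y by move=> _ [i _ <-]; exact: (yP i).1.
  have [m' [mX _]] := finite_bigmeet dmS (sub_finite_set YX finY) X0.
  have [i mi] := XF _ X0 YX cX _ mX.
  by apply: (yP i).2; apply: leE mi; apply: mX.1; exists i.
- by move=> u w [i /designated1_join[]]; [left|right]; exists i.
Qed.

Lemma prime_nfilters_of_substructures n L :
  0 < n -> complete_substructures n L -> complete_prime_nfilters n L.
Proof.
move=> n0 [K [KDM LK]]; exists K; split=> //.
  exact: finite_substructures KDM.
move=> _ /KDM[S [HS ->]]; split.
- exact: finite_sub_DM.
- exact: subalgebra_demorgan (DM_demorgan n).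
- exact: sub_DM_prime_nfilter.
Qed.

(** * Compactness and finitarity *)

Lemma valid_eval (M : structure) Gamma phi :
  valid M Gamma phi <->
  forall f : nat -> M,
    (forall gamma, Gamma gamma -> designated M (eval f gamma)) ->
    designated M (eval f phi).
Proof.
split=> [val f fG|val v hv vG].
  by apply: val => // _ [gamma Gg <-]; exact: fG.
rewrite (homE hv); apply: val => gamma Gg; rewrite -(homE hv).
by apply: vG; exists gamma.
Qed.

(* Koenig's lemma on the tree of finite partial valuations that no finite part
   of Gamma excludes. *)
Lemma valid_compact (M : structure) Gamma phi : finite_structure M ->
  valid M Gamma phi ->
  exists G0, [/\ G0 `<=` Gamma, finite_set G0 & valid M G0 phi].
Proof.
move=> finM val; apply: contrapT => noG0.
(* The first [k] values of [g] extend, for each finite part of [Gamma], to a valuation refuting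
   [phi] from it. *)
pose P k (g : nat -> M) := forall G0, G0 `<=` Gamma -> finite_set G0 ->
  exists f : nat -> M,
    [/\ forall gamma, G0 gamma -> designated M (eval f gamma),
    ~ designated M (eval f phi) & forall i, i < k -> f i = g i].
pose upd (g : nat -> M) k a i := if i == k then a else g i.
have [a0] := carrier_nonempty M.
have P0 g : P 0 g.
  move=> G0 sG finG; apply: contrapT => nof; apply: noG0; exists G0; split=> //.
  by apply/valid_eval => f fG; apply: contrapT => nphi; apply: nof; exists f.
(* If each value [a] for variable [k] were excluded by a finite [G a], the union of these over the
   finite [M] would exclude [g] itself. *)
have step (kg : nat * (nat -> M)) :
    exists a, P kg.1 kg.2 -> P kg.1.+1 (upd kg.2 kg.1 a).
  case: kg => k g /=; apply: contrapT => /forallNP noa.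
  have Pk : P k g by apply: contrapT => nP; apply: (noa a0) => /nP.
  have /choice[G GP] a : exists G0, [/\ G0 `<=` Gamma, finite_set G0 &
      ~ exists f : nat -> M,
        [/\ forall gamma, G0 gamma -> designated M (eval f gamma),
        ~ designated M (eval f phi) & forall i, i < k.+1 -> f i = upd g k a i]].
    apply: contrapT => nG; apply: (noa a) => _ G0 sG finG.
    by apply: contrapT => nof; apply: nG; exists G0.
  have [||f [fG fphi fg]] := Pk (\bigcup_(a in [set: M]) G a).
  - by move=> gamma [a _]; have [+ _ _] := GP a; apply.
  - by apply: bigcup_finite => // a _; have [] := GP a.
  have [_ _] := GP (f k); apply; exists f; split=> // [gamma Gg|i].
    by apply: fG; exists (f k).
  rewrite ltnS leq_eqVlt /upd; have [->//|_ /= ik] := eqVneq i k; exact: fg.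
have /choice[next nextP] := step.
pose g := fix g k := if k is k'.+1 then upd (g k') k' (next (k', g k'))
                     else fun=> a0.
have Pg k : P k (g k).
  by elim: k => [|k IH]; [exact: P0|exact: (nextP (k, g k))].
(* Value [i] is fixed at stage [i.+1] and never changes, so [w] is the infinite branch. *)
pose w i := g i.+1 i.
have gw k i : i < k -> g k i = w i.
  elim: k => [//|k IH]; rewrite ltnS leq_eqVlt => /orP[/eqP ->//|ik].
  by rewrite /= /upd ltn_eqF ?IH.
have wf phi' : exists k, forall f : nat -> M,
    (forall i, i < k -> f i = g k i) ->
    eval f phi' = eval w phi'.
  by exists (var_bound phi') => f fg; apply: eq_eval => i ib; rewrite fg ?gw.
(* A formula sees only finitely many variables: the empty premise set at a late stage shows that [w]
   refutes [phi], and singletons show that it satisfies each [gamma]. *)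
have [k kphi] := wf phi.
have [//|f [_ fphi /kphi fw]] := Pg k set0 (@sub0set _ _).
apply: fphi; rewrite fw; move/valid_eval: val; apply => gamma Gg.
have [k' kgamma] := wf gamma.
have [_ ->//|//|f' [f'G _ /kgamma <-]] := Pg k' [set gamma].
exact: f'G.
Qed.

Lemma finitely_generated_finitary L : finitely_generated L -> finitary L.
Proof.
move=> [K [finK Kfin LK]] Gamma phi /LK det.
have /choice[G GP] (M : structure) : exists G0, K M ->
    [/\ G0 `<=` Gamma, finite_set G0 & valid M G0 phi].
  have [KM|nKM] := pselect (K M); last by exists set0.
  by have [G0 h] := valid_compact (Kfin _ KM) (det _ KM); exists G0.
exists (\bigcup_(M in K) G M); split.
- by move=> gamma [M /GP[+ _ _]]; apply.
- by apply: bigcup_finite => // M /GP[].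
- apply/LK => M KM v hv vG; have [_ _ val] := GP M KM.
  by apply: val => // _ [gamma Gg <-]; apply: vG; exists gamma => //; exists M.
Qed.

(** * The rule of BD_n and the PCP from prime n-filters, from (iii) to (i) *)

Lemma extends_BD n L : is_logic L -> extends L BD_infty ->
  L (BD_rule_premises n) (BD_rule_conclusion n) -> extends L (BD n).
Proof. by move=> lL extL rule Gamma phi; apply => // ? ? [-> ->]. Qed.

Lemma card_le_pigeonhole T (X : set T) n (f : nat -> T) :
    (X #<= `I_n)%card -> (forall i, i < n.+1 -> X (f i)) ->
  exists i j, [/\ i < n.+1, j < n.+1, i != j & f i = f j].
Proof.
move=> Xn fX; apply: contrapT => nij.
have finj : {in `I_n.+1 &, injective f}.
  move=> i j; rewrite !inE /= => ilt jlt fij; apply: contrapT => /eqP ij.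
  by apply: nij; exists i, j.
have /card_le_trans/(_ Xn) : (f @` `I_n.+1 #<= X)%card.
  by apply: subset_card_le => _ [i ilt <-]; exact: fX.
by rewrite (card_le_eql (inj_card_eq finj)) card_le_II ltnn.
Qed.

(* A subset of {x_0, ..., x_n} with at most n elements misses some x_i, unless
   two of the x_j coincide; either way the i-th premise bounds its meet. *)
Lemma prime_nfilter_BD_rule n (M : structure) : 0 < n ->
  is_demorgan_lattice M -> is_prime_nfilter n (designated M) ->
  valid M (BD_rule_premises n) (BD_rule_conclusion n).
Proof.
move=> n0 dmM [[upM nfM] _] v hv vprem.
have refl := @lat_le_refl _ dmM.
have prem_le i j : j != i -> j < n.+1 ->
    lat_le (v (bigAnd [seq Var j | j <- iota 0 n.+1 & j != i])) (v (Var j)).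
  move=> ji jlt; have /(le_bigAnd _ dmM hv (iota_filter_neq0 i n0)) := refl
    (v (bigAnd [seq Var j | j <- iota 0 n.+1 & j != i])).
  by apply; rewrite mem_iota_filter ji.
apply: (nfM [set v (Var j) | j in `I_n.+1]).
- exact: finite_image.
- by exists (v (Var 0)); exists 0.
- move=> X X0 XY Xn m [_ mge].
  have [i ilt Xi] : exists2 i, i < n.+1 & forall x, X x ->
      exists j, [/\ j != i, j < n.+1 & x = v (Var j)].
    apply: contrapT => noi.
    (* If no index can be omitted, the [n.+1] values are distinct members of [X], contradicting its
       size. *)
    have Xv i : i < n.+1 -> X (v (Var i)) /\
        forall j, j != i -> j < n.+1 -> v (Var i) <> v (Var j).
      move=> ilt; apply: contrapT => nXi; apply: noi; exists i => // x Xx.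
      apply: contrapT => noj; have [j jlt xj] := XY x Xx.
      have ji : j = i.
        by apply: contrapT => /eqP ji; apply: noj; exists j.
      apply: nXi; rewrite -ji xj; split=> // k kj klt xk.
      by apply: noj; exists k; rewrite -ji.
    have [i [j [ilt jlt ij vij]]] :=
      card_le_pigeonhole Xn (fun i h => (Xv i h).1).
    by apply: (Xv i ilt).2 vij => //; rewrite eq_sym.
  apply: (upM _ _ _ (mge _ _)); first last.
    by move=> x /Xi[j [ji jlt ->]]; exact: prem_le ji jlt.
  apply: vprem; eexists; last reflexivity.
  by exists i.
- split=> [_ [j jlt <-]|z zle].
    have /(le_bigAnd _ dmM hv) := refl (v (BD_rule_conclusion n)).
    by apply => //; rewrite mem_iota.
  apply/(le_bigAnd _ dmM hv) => // j; rewrite mem_iota => jlt.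
  by apply: zle; exists j.
Qed.

Lemma PCP_of_prime_nfilters n L : 0 < n -> is_logic L -> extends L BD_infty ->
  complete_prime_nfilters n L -> finitary_PCP_extension n L.
Proof.
move=> n0 lL extL [K [finK KP LK]]; split.
- by apply: finitely_generated_finitary; exists K; split=> // M /KP[].
- apply: extends_BD => //; apply/LK => M /KP[_ dmM pM].
  exact: prime_nfilter_BD_rule.
- move=> Gamma a b psi /LK La /LK Lb; apply/LK => M KM v hv vG.
  have [_ _ [_ pM]] := KP M KM.
  have [_ vj _] := hv.
  have : designated M (v (Or a b)) by apply: vG; exists (Or a b) => //; right.
  (* Primeness reduces the disjunctive premise to one of its disjuncts. *)
  rewrite (vj a b) => /pM[va|vb]; [apply: La hv _ => //|apply: Lb hv _ => //].
    by move=> _ [c [Gc|->] <-//]; apply: vG; exists c => //; left.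
  by move=> _ [c [Gc|->] <-//]; apply: vG; exists c => //; left.
Qed.

(** * Finitely generated extensions *)

(* In a structure with at most n elements two of the n + 1 variables of the
   rule get the same value; identifying them turns the conclusion into a
   consequence of a single premise. *)
Lemma finitely_generated_BD L : is_logic L -> extends L BD_infty ->
  finitely_generated L -> exists2 n, 0 < n & extends L (BD n).
Proof.
move=> lL extL [K [finK Kfin LK]].
have /choice[N NP] (M : structure) :
    exists k, K M -> ([set: M] #<= `I_k)%card.
  have [KM|nKM] := pselect (K M); last by exists 0.
  by have /finite_set_leP[k] := Kfin _ KM; exists k.
have /finite_seqP[s Ks] : finite_set (N @` K) by exact: finite_image.
(* A common bound on the sizes of the generating structures; the successor makes it positive. *)
pose n := (\max_(i <- s) i).+1.
exists n => //; apply: extends_BD => //; apply/LK => M KM v hv vprem.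
have Mn : ([set: M] #<= `I_n)%card.
  apply: card_le_trans (NP M KM) _; rewrite card_le_II; apply: leqW.
  have : (N @` K) (N M) by exists M.
  by rewrite Ks => /= Ns; exact: (leq_bigmax_seq (F := id)).
have [i [j [ilt jlt ij vij]]] :=
  card_le_pigeonhole (f := fun i => v (Var i)) Mn (fun _ _ => I).
pose s0 k : formula_algebra := Var (if k == i then j else k).
have vs : v \o eval s0 = v.
  rewrite [LHS](homE (is_hom_comp hv (eval_hom s0))) [RHS](homE hv).
  by congr eval; apply/funext => k; rewrite /= /s0; case: eqP => // ->.
rewrite -vs /=.
pose prem := bigAnd [seq Var j | j <- iota 0 n.+1 & j != i].
(* After replacing [Var i] by [Var j], every conjunct of the conclusion occurs in the premise
   omitting [i]. *)
have /fle_BD_infty/extL/LK/(_ M KM v hv) :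
    fle prem (eval s0 (BD_rule_conclusion n)).
  move=> A dmA w hw; have h := is_hom_comp hw (eval_hom s0).
  apply/(le_bigAnd _ dmA h) => // k; rewrite mem_iota => klt /=.
  have /(le_bigAnd _ dmA hw (iota_filter_neq0 i (ltn0Sn _))) :=
    lat_le_refl dmA (w prem).
  apply; rewrite mem_iota_filter; have [_|->//] := eqVneq k i.
  by rewrite eq_sym ij.
apply => _ [_ -> <-]; apply: vprem; exists prem => //.
by exists i.
Qed.

Theorem mainTheorem12 :
  (forall (n : nat), 1 <= n ->
   forall (L : consequence), is_logic L -> extends L BD_infty ->
     (finitary_PCP_extension n L <-> complete_substructures n L) /\
     (complete_substructures n L <-> complete_prime_nfilters n L)) /\
  (forall (L : consequence), is_logic L -> extends L BD_infty ->
     finitely_generated L -> PCP L ->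
     exists n : nat,
       [/\ 1 <= n, finitary_PCP_extension n L, complete_substructures n L
         & complete_prime_nfilters n L]).
Proof.
split=> [n n0 L lL extL|L lL extL fgL pcpL].
  have h12 := substructures_of_PCP lL n0 extL.
  have h23 := @prime_nfilters_of_substructures n L n0.
  have h31 := PCP_of_prime_nfilters n0 lL extL.
  by tauto.
have [n n0 extn] := finitely_generated_BD lL extL fgL.
have Ln : finitary_PCP_extension n L.
  by split=> //; exact: finitely_generated_finitary.
have Lsub := substructures_of_PCP lL n0 extL Ln.
by exists n; split=> //; exact: prime_nfilters_of_substructures.
Qed.
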